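(* Let $T\in\mathcal{L}(\mathcal{H})$ have closed range and let $p$ be a complex polynomial in one variable such that $p(0)=0$. The following assertions are equivalent: (1) $T$ is $p$-EP; (2) $TT^\dagger\,(T^\dagger p(T))^*=(T^\dagger p(T))^*$ and $T^\dagger T\,p(T)\,T^\dagger=p(T)\,T^\dagger$; (3) $p(T)TT^\dagger+\left(p(T)TT^\dagger\right)^*=p(T)+\overline{p}(T^* )$ and $T^\dagger p(T)T+\left(T^\dagger p(T)T\right)^*=p(T)+\overline{p}(T^* )$.
   Context: $\mathcal{H}$ is a complex Hilbert space and $\mathcal{L}(\mathcal{H})$ is the algebra of bounded linear operators on $\mathcal{H}$. For $T\in\mathcal{L}(\mathcal{H})$ with closed range, the Moore-Penrose inverse $T^\dagger$ is the unique operator with $TT^\dagger T=T$, $T^\dagger TT^\dagger=T^\dagger$, $(T^\dagger T)^*=T^\dagger T$, $(TT^\dagger)^*=TT^\dagger$. For a complex polynomial $p$, $\overline{p}$ is the polynomial with conjugated coefficients, $\overline{p}(z)=\overline{p(\overline{z})}$, so that $(p(T))^*=\overline{p}(T^* )$. For a complex polynomial $p$ (the notion is introduced for nontrivial $p$), a closed range operator $T$ is $p$-EP if $p(T)T^\dagger=T^\dagger p(T)$. *)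

(* Defs.v *)
From HB Require Import structures.
From mathcomp Require Import all_boot all_order all_algebra.
From mathcomp Require Import complex.
From mathcomp Require Import all_classical all_reals all_analysis.
Import Order.TTheory GRing.Theory Num.Theory.
Import numFieldNormedType.Exports.

Set Implicit Arguments.
Unset Strict Implicit.
Unset Printing Implicit Defensive.

Local Open Scope classical_set_scope.
Local Open Scope ring_scope.

(* [{dot V for Num.conj}] is linear in its first argument and conjugate-linear
   in the second. *)
Record hilbertType (R : realType) := Hilbert {
  hilbert_sort :> completeNormedModType R[i];
  inner : {dot hilbert_sort for Num.conj};
  sqr_normE : forall x : hilbert_sort, `|x| ^+ 2 = inner x x
}.

Arguments inner {R h}.

Section Operators.
Context {R : realType} {H : hilbertType R}.
Implicit Types (T S X : H -> H) (p : {poly R[i]}).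

Definition bounded_operator T : Prop :=
  linear T /\ exists M : R[i], forall x, `|T x| <= M * `|x|.

Definition is_adjoint T S : Prop :=
  bounded_operator S /\ forall x y, inner (T x) y = inner x (S y).

(* [get] is the choice operator: when no adjoint exists (which cannot happen
   for a bounded operator, by the Riesz representation theorem) the value is
   irrelevant. *)
Definition adjoint T : H -> H := get [set S | is_adjoint T S].

Definition is_mp_inverse T X : Prop :=
  [/\ bounded_operator X,
      T \o X \o T = T,
      X \o T \o X = X,
      adjoint (X \o T) = X \o T
    & adjoint (T \o X) = T \o X].

(* As for [adjoint], meaningful when a Moore-Penrose inverse exists, that is,
   for a bounded operator with closed range. *)
Definition mp_inverse T : H -> H := get [set X | is_mp_inverse T X].

(* [horner] does not apply: the operators form the zero ring when [H] is the
   zero space. *)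
Definition poly_op p T : H -> H :=
  fun x => \sum_(i < size p) p`_i *: iter i T x.

Definition p_EP p T : Prop :=
  closed (range T) /\
  poly_op p T \o mp_inverse T = mp_inverse T \o poly_op p T.

End Operators.

Definition conj_poly (R : realType) (p : {poly R[i]}) : {poly R[i]} :=
  map_poly Num.conj p.

Notation "T ^\star" := (adjoint T)
  (at level 1, left associativity, format "T ^\star") : ring_scope.
Notation "T ^\dag" := (mp_inverse T)
  (at level 1, left associativity, format "T ^\dag") : ring_scope.

(* Main.v *)
Require Import Defs.
From mathcomp Require Import all_boot all_order all_algebra.
From mathcomp Require Import complex.
From mathcomp Require Import all_classical all_reals all_analysis.
From mathcomp Require Import ring lra.
Import Order.TTheory GRing.Theory Num.Theory.
Import numFieldNormedType.Exports.
Local Open Scope classical_set_scope.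
Local Open Scope ring_scope.

(** Write [X] for the Moore-Penrose inverse of [T], [A] for [p(T)], and
    [P = T X], [Q = X T] for the orthogonal projections on the range of [T] and
    on the orthogonal of its kernel.  Since [p(0) = 0], the operator [A] is a
    multiple of [T] on both sides, so that [P A = A], [A Q = A] and
    [A T = T A].  Each of the three assertions then says that [A P = A] and
    [Q A = A].
    - Commutation of [A] and [X] gives (2) by rewriting: for instance
      [X A P = A X T X = A X = X A], whose adjoint is the first half of (2).
    - Conversely (2) gives [A P = A] and [Q A = A] by multiplying with [T];
      then [A T X] and [X A T] both equal [A], and (3) holds.
    - From (3), [P A] and [A Q] being [A], composing the first equation with [P]
      on the left cancels everything except [A P = A], and composing the second
      one with [Q] on the right leaves [Q A = A].  Then
      [A X = Q A X = X A T X = X A].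

    This algebra presupposes that adjoints and Moore-Penrose inverses exist,
    and most of the work goes there.  The orthogonal decomposition along a
    subspace ([orthogonal_decomposition]) yields the representation of bounded
    functionals ([riesz_representation]), hence adjoints.  For the
    Moore-Penrose inverse it produces, for each [y], the solution [x] of
    [T x = P y] orthogonal to the kernel; what remains is that [x] depends
    boundedly on [y].  Instead of the open mapping theorem, the argument uses
    uniform boundedness in its Hilbert space form ([uniform_boundedness]): it
    makes [T^\star] bounded below on the range of [T]
    ([adjoint_bounded_below]), and this lower bound passes to [T] on the
    orthogonal of its kernel ([bounded_below_ker_orth]). *)

(** * Real-valued norms *)

Section RealNorm.
Context {R : realType}.

(** The norm of a complex normed space takes its values in [R[i]], whose order
    is only partial; its real part carries the same information and lives in
    [R]. *)
Definition rnorm {V : normedZmodType R[i]} (x : V) : R := complex.Re `|x|.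

Lemma rnormE {V : normedZmodType R[i]} (x : V) : `|x| = (rnorm x)%:C%C.
Proof. by rewrite /rnorm RRe_real// ger0_real. Qed.

Lemma rnorm_ge0 {V : normedZmodType R[i]} (x : V) : 0 <= rnorm x.
Proof. by rewrite -ler0c -rnormE. Qed.

Lemma rnorm_eq0 {V : normedZmodType R[i]} (x : V) : rnorm x = 0 -> x = 0.
Proof. by move=> x0; apply/eqP; rewrite -normr_eq0 rnormE x0. Qed.

Lemma rnorm0 {V : normedZmodType R[i]} : rnorm (0 : V) = 0.
Proof. by rewrite /rnorm normr0. Qed.

Lemma rnormD {V : normedZmodType R[i]} (x y : V) :
  rnorm (x + y) <= rnorm x + rnorm y.
Proof. by rewrite -lecR rmorphD /= -!rnormE ler_normD. Qed.

Lemma rnormN {V : normedZmodType R[i]} (x : V) : rnorm (- x) = rnorm x.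
Proof. by rewrite /rnorm normrN. Qed.

Lemma rnormBC {V : normedZmodType R[i]} (x y : V) : rnorm (x - y) = rnorm (y - x).
Proof. by rewrite /rnorm distrC. Qed.

Lemma rnormM (a b : R[i]) : rnorm (a * b) = rnorm a * rnorm b.
Proof. by apply: complexI; rewrite rmorphM /= -!rnormE normrM. Qed.

Lemma rnormZ {V : normedModType R[i]} (a : R[i]) (x : V) :
  rnorm (a *: x) = rnorm a * rnorm x.
Proof. by apply: complexI; rewrite rmorphM /= -!rnormE normrZ. Qed.

Lemma rnorm_real (a : R) : 0 <= a -> rnorm (a%:C%C : R[i]) = a.
Proof. by move=> a0; apply: complexI; rewrite -rnormE ger0_norm// ler0c. Qed.

Lemma rnormJ (a : R[i]) : rnorm (Num.conj a) = rnorm a.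
Proof. by rewrite /rnorm norm_conjC. Qed.

End RealNorm.

(** * Limits in terms of real-valued norms *)

Section Convergence.
Context {R : realType}.
Implicit Types (V : completeNormedModType R[i]).

(** Membership in the topological closure, with real instead of complex
    positive radii. *)
Definition adherent {V} (A : set V) (x : V) : Prop :=
  forall e : R, 0 < e -> exists2 a, A a & rnorm (x - a) < e.

Lemma closed_adherent {V} (A : set V) x : closed A -> adherent A x -> A x.
Proof.
move=> cA adh; apply: cA => B /nbhs_ballP[e /= e0 eB].
have e_real : (complex.Re e)%:C%C = e by rewrite RRe_real// gtr0_real.
have [|a Aa xa] := adh (complex.Re e); first by rewrite -ltcR e_real.
exists a; split=> //; apply: eB; rewrite -ball_normE /ball_ /=.
by rewrite rnormE -e_real ltcR.
Qed.

Lemma cauchy_limit {V} (u : nat -> V) :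
  (forall e : R, 0 < e ->
     exists N, forall n, (N <= n)%N -> rnorm (u N - u n) < e) ->
  exists l, forall e : R, 0 < e ->
     exists N, forall n, (N <= n)%N -> rnorm (l - u n) < e.
Proof.
move=> cu; have : cvg (u @ \oo).
  apply: cauchy_cvg; apply: cauchy_exP => e e0.
  have e_real : (complex.Re e)%:C%C = e by rewrite RRe_real// gtr0_real.
  have [|N uN] := cu (complex.Re e); first by rewrite -ltcR e_real.
  exists (u N), N => // n /= Nn; rewrite -ball_normE /ball_ /=.
  by rewrite rnormE -e_real ltcR uN.
move=> /cvg_ex[l /cvgrPdist_lt ul]; exists l => e e0.
have [|N _ uN] := ul e%:C%C; first by rewrite ltcR.
by exists N => n Nn; rewrite -ltcR -rnormE; exact: uN.
Qed.

Lemma inv_natS_small (e : R) : 0 < e ->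
  exists N, forall n, (N <= n)%N -> n.+1%:R^-1 < e.
Proof.
move=> e0; exists (Num.truncn e^-1) => n Nn.
rewrite -ltf_pV2 ?posrE ?invr_gt0// invrK.
by rewrite (lt_le_trans (truncnS_gt _))// ler_nat.
Qed.

Lemma le0_small (a b : R) : 0 <= b -> (forall e, 0 < e -> a <= e * b) -> a <= 0.
Proof.
move=> b0 ab; rewrite leNgt; apply/negP => a0.
have b1 : 0 < b + 1 by rewrite ltr_wpDl.
have := ab (a / (b + 1)) (divr_gt0 a0 b1).
by rewrite mulrAC ler_pdivlMr// ler_pM2l// gerDl ler10.
Qed.

Lemma adherent_kernel {V} (W : normedZmodType R[i]) (f : V -> W) (M : R) m :
    0 <= M -> (forall x y, f (x - y) = f x - f y) ->
    (forall x, rnorm (f x) <= M * rnorm x) ->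
  adherent [set v | f v = 0] m -> f m = 0.
Proof.
move=> M0 fB fM m_adh; apply: rnorm_eq0; apply/le_anti; rewrite rnorm_ge0 andbT.
apply: (le0_small _ M) => // e e0; have [v /= fv mv] := m_adh e e0.
rewrite -[f m]subr0 -fv -fB mulrC; apply: le_trans (fM _) _.
by rewrite ler_wpM2l// ltW.
Qed.

End Convergence.

(** * Inner products and orthogonal decomposition *)

Section InnerProduct.
Context {R : realType} {H : hilbertType R}.
Implicit Types (x y z v w : H) (a : R[i]).

Lemma innerDl x y z : inner (x + y) z = inner x z + inner y z.
Proof. exact: linearDl. Qed.
Lemma innerBl x y z : inner (x - y) z = inner x z - inner y z.
Proof. exact: linearBl. Qed.
Lemma innerZl a x z : inner (a *: x) z = a * inner x z.
Proof. exact: linearZl_LR. Qed.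
Lemma innerDr x y z : inner z (x + y) = inner z x + inner z y.
Proof. exact: linearDr. Qed.
Lemma innerBr x y z : inner z (x - y) = inner z x - inner z y.
Proof. exact: linearBr. Qed.
Lemma innerZr a x z : inner z (a *: x) = Num.conj a * inner z x.
Proof. exact: linearZr_LR. Qed.
Lemma inner0l z : inner 0 z = 0 :> R[i].
Proof. exact: linear0l. Qed.
Lemma innerC x y : inner x y = Num.conj (inner y x).
Proof. by rewrite hermC expr0 mul1r. Qed.

Lemma inner_self x : inner x x = (rnorm x ^+ 2)%:C%C.
Proof. by rewrite -sqr_normE rnormE rmorphXn. Qed.

Lemma rnorm_innerC x y : rnorm (inner x y) = rnorm (inner y x).
Proof. by rewrite innerC rnormJ. Qed.

Lemma inner_inj x y : (forall z, inner z x = inner z y) -> x = y.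
Proof.
move=> xy; apply/eqP; rewrite -subr_eq0; apply/eqP/rnorm_eq0/eqP.
rewrite -sqrf_eq0 -(inj_eq (@complexI R)) -inner_self.
by rewrite innerBr xy subrr.
Qed.

(** Subtracting from [w] its component along [v] lowers the squared norm of [w]
    by [|<w, v>|^2 / |v|^2]; so a lower bound [c] on the squared distance from [w]
    to the line spanned by [v] bounds [<w, v>].  The value [c = 0] gives the
    Cauchy-Schwarz inequality; for [c] close to [|w|^2] the vector [w] is almost
    orthogonal to [v]. *)
Lemma inner_le_gap w v (c : R) :
    (forall a, c <= rnorm (w - a *: v) ^+ 2) ->
  rnorm (inner w v) ^+ 2 <= (rnorm w ^+ 2 - c) * rnorm v ^+ 2.
Proof.
move=> cP; have [v0|v0] := eqVneq (rnorm v) 0.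
  by rewrite (rnorm_eq0 _ v0) innerC inner0l rmorph0 !rnorm0 expr0n mulr0.
set k := inner w v; set t := rnorm v ^+ 2.
have t0 : 0 < t by rewrite exprn_gt0// lt_neqAle eq_sym v0 rnorm_ge0.
have tC : t%:C%C != 0 :> R[i] by rewrite (inj_eq (@complexI R) _ 0) gt_eqF.
(* the coefficient for which [w - a *: v] is orthogonal to [v] *)
have := cP (k / t%:C%C).
suff -> : rnorm (w - (k / t%:C%C) *: v) ^+ 2 = rnorm w ^+ 2 - rnorm k ^+ 2 / t.
  rewrite lerBrDr addrC -lerBrDr ler_pdivrMr//.
have kk : k * Num.conj k = (rnorm k ^+ 2)%:C%C.
  by rewrite -normCK rnormE rmorphXn.
have ka : Num.conj (k / t%:C%C) = Num.conj k / t%:C%C.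
  by rewrite fmorph_div /=; congr (_ / _); exact: conjc_real.
have rhs : (rnorm w ^+ 2 - rnorm k ^+ 2 / t)%:C%C =
    (rnorm w ^+ 2)%:C%C - k * Num.conj k / t%:C%C :> R[i].
  by rewrite kk -fmorph_div -rmorphB.
apply: complexI; rewrite -inner_self rhs.
rewrite innerBl !innerBr !innerZl !innerZr !inner_self (innerC v w) -/k -/t ka.
by field.
Qed.

Lemma cauchy_schwarz x y : rnorm (inner x y) <= rnorm x * rnorm y.
Proof.
rewrite -ler_sqr ?nnegrE ?mulr_ge0 ?rnorm_ge0// exprMn.
rewrite -[X in _ <= X * _]subr0; apply: inner_le_gap => a.
exact: sqr_ge0.
Qed.

(** A sequence [u] in [V] that minimizes the distance to [x] is Cauchy because
    [x - u n] is almost orthogonal to [V], in particular to [u n - u m], whose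
    squared norm is the difference of two such small inner products.  The limit
    is only adherent to [V], which is not assumed closed: the decomposition is
    also applied to the range of [T^\star \o T]. *)
Lemma orthogonal_decomposition (V : set H) x :
    V 0 -> (forall a u v, V u -> V v -> V (a *: u + v)) ->
  exists2 m, adherent V m & forall v, V v -> inner (x - m) v = 0.
Proof.
move=> V0 Vlin.
pose D := [set rnorm (x - v) ^+ 2 | v in V].
have Dinf : has_inf D.
  split; first by exists (rnorm (x - 0) ^+ 2), 0.
  by exists 0 => _ [v _ <-]; exact: sqr_ge0.
set d := inf D.
have dP v : V v -> d <= rnorm (x - v) ^+ 2.
  by move=> Vv; apply: ge_inf; [exact: (proj2 Dinf)|exists v].
have near (n : nat) : exists u, V u /\ rnorm (x - u) ^+ 2 < d + n.+1%:R^-1 ^+ 2.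
  have [|_ [u Vu <-] ud] := @inf_adherent _ D (n.+1%:R^-1 ^+ 2) _ Dinf.
    by rewrite exprn_gt0.
  by exists u.
have [u uP] := choice near.
have orth n v : V v -> rnorm (inner (x - u n) v) <= n.+1%:R^-1 * rnorm v.
  move=> Vv; have [Vu ud] := uP n.
  rewrite -ler_sqr ?nnegrE ?mulr_ge0 ?rnorm_ge0// exprMn.
  apply: le_trans (inner_le_gap _ _ d _) _ => [a|].
    by rewrite -addrA -opprD dP// addrC; exact: Vlin.
  by rewrite ler_wpM2r ?sqr_ge0// lerBlDl ltW.
have du n m : rnorm (u n - u m) <= n.+1%:R^-1 + m.+1%:R^-1.
  have Vnm : V (u n - u m).
    by rewrite addrC -scaleN1r; apply: Vlin; apply: (uP _).1.
  have [->|nm] := eqVneq (rnorm (u n - u m)) 0; first by rewrite addr_ge0.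
  have nm0 : 0 < rnorm (u n - u m) by rewrite lt_neqAle eq_sym nm rnorm_ge0.
  rewrite -(ler_pM2r nm0) -expr2.
  rewrite -[leLHS](@rnorm_real R) ?sqr_ge0// -inner_self.
  have -> : inner (u n - u m) (u n - u m) =
      inner (x - u m) (u n - u m) - inner (x - u n) (u n - u m).
    by rewrite -innerBl; congr (inner _ _); rewrite opprB [RHS]addrC addrA subrK.
  apply: le_trans (rnormD _ _) _; rewrite rnormN mulrDl addrC.
  by apply: lerD; exact: orth.
have [|m um] := cauchy_limit u.
  move=> e e0; have [|N NP] := inv_natS_small (e / 2); first by rewrite divr_gt0.
  exists N => n Nn; apply: le_lt_trans (du _ _) _.
  by rewrite [e]splitr ltrD// NP.
exists m.
  move=> e e0; have [N NP] := um e e0; exists (u N); first exact: (uP _).1.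
  exact: NP.
move=> v Vv; apply: rnorm_eq0; apply/le_anti; rewrite rnorm_ge0 andbT.
apply: le0_small (rnorm_ge0 v) _ => e e0.
have e2 : 0 < e / 2 by rewrite divr_gt0.
have [N NP] := inv_natS_small _ e2; have [M MP] := um _ e2.
pose n := maxn N M.
have -> : inner (x - m) v = inner (x - u n) v - inner (m - u n) v.
  by rewrite -innerBl opprB addrA subrK.
apply: le_trans (rnormD _ _) _; rewrite rnormN [e]splitr mulrDl; apply: lerD.
  apply: le_trans (orth n v Vv) _.
  by rewrite ler_wpM2r ?rnorm_ge0// ltW// NP// leq_maxl.
apply: le_trans (cauchy_schwarz _ _) _.
by rewrite ler_wpM2r ?rnorm_ge0// ltW// MP// leq_maxr.
Qed.
End InnerProduct.

(** * Adjoints of bounded operators *)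

Section LinearMaps.
Context {K : pzRingType} {U V : lmodType K} {f : U -> V} (lf : linear f).

Lemma linear_fun0 : f 0 = 0.
Proof. by have := lf (-1) 0 0; rewrite scaler0 addr0 scaleN1r addNr. Qed.

Lemma linear_funZ a x : f (a *: x) = a *: f x.
Proof. by rewrite -[a *: x]addr0 lf linear_fun0 addr0. Qed.

Lemma linear_funD x y : f (x + y) = f x + f y.
Proof. by rewrite -[x]scale1r lf !scale1r. Qed.

Lemma linear_funB x y : f (x - y) = f x - f y.
Proof. by rewrite -scaleN1r linear_funD linear_funZ scaleN1r. Qed.

End LinearMaps.

Section Adjoints.
Context {R : realType} {H : hilbertType R}.
Implicit Types (T S X : H -> H) (x y z v w : H).

Lemma bounded_rnorm T : bounded_operator T ->
  exists2 M : R, 0 <= M & forall x, rnorm (T x) <= M * rnorm x.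
Proof.
move=> [_ [M TM]]; exists (rnorm M); first exact: rnorm_ge0.
move=> x; rewrite -lecR rmorphM /= -!rnormE.
have Mx : 0 <= M * `|x| by exact: le_trans (TM x).
by rewrite -[`|x|]normr_id -normrM ger0_norm.
Qed.

Lemma rnorm_bounded T (M : R) : linear T ->
  (forall x, rnorm (T x) <= M * rnorm x) -> bounded_operator T.
Proof.
move=> lT TM; split=> //; exists M%:C%C => x.
by rewrite !rnormE -rmorphM lecR.
Qed.

(** The functional is recovered from any vector [w] that it does not
    annihilate and that is orthogonal to its kernel, since [x - (f x / f w) w]
    lies in the kernel. *)
Lemma riesz_representation (f : H -> R[i]) (M : R) :
    (forall a x y, f (a *: x + y) = a * f x + f y) -> 0 <= M ->
    (forall x, rnorm (f x) <= M * rnorm x) ->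
  exists y, forall x, f x = inner x y.
Proof.
move=> lf M0 fM.
have f0 : f 0 = 0 by have := lf (-1) 0 0; rewrite scaler0 addr0 mulN1r addNr.
have [fz|/existsNP[z fz]] := pselect (forall z, f z = 0).
  by exists 0 => x; rewrite fz innerC inner0l rmorph0.
have [//|a u v /= fu fv|m m_adh m_orth] :=
  orthogonal_decomposition [set v | f v = 0] z.
  by rewrite lf fu fv mulr0 addr0.
have fB x y : f (x - y) = f x - f y.
  by rewrite [x - y]addrC -scaleN1r lf mulN1r [LHS]addrC.
have fm : f m = 0 by exact: adherent_kernel M0 fB fM m_adh.
set w := z - m; have fw : f w != 0 by rewrite fB fm subr0; exact/eqP.
have ww : inner w w != 0.
  by rewrite dnorm_eq0; apply: contraNneq fw => ->; rewrite f0.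
exists (Num.conj (f w / inner w w) *: w) => x.
have : inner (x - (f x / f w) *: w) w = 0.
  rewrite innerC m_orth ?rmorph0//=.
  by rewrite addrC -scaleNr lf mulNr divfK// addNr.
rewrite innerBl innerZl => /subr0_eq xw.
by rewrite innerZr conjCK xw; field; rewrite fw ww.
Qed.

Lemma adjoint_exists T : bounded_operator T -> exists S, is_adjoint T S.
Proof.
move=> bT; have lT := bT.1; have [M M0 TM] := bounded_rnorm T bT.
have repr y : exists z, forall x, inner (T x) y = inner x z.
  apply: (riesz_representation _ (M * rnorm y)).
  - by move=> a u v; rewrite lT innerDl innerZl.
  - by rewrite mulr_ge0// rnorm_ge0.
  - move=> x; apply: le_trans (cauchy_schwarz _ _) _.
    by rewrite mulrAC ler_wpM2r ?rnorm_ge0.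
have [S TS] := choice repr; exists S; split; last by move=> x y; exact: TS.
apply: (rnorm_bounded _ M).
  move=> a u v; apply: inner_inj => x.
  by rewrite -TS !innerDr !innerZr !TS.
move=> y; have [->|y0] := eqVneq (rnorm (S y)) 0.
  by rewrite mulr_ge0// rnorm_ge0.
have {}y0 : 0 < rnorm (S y) by rewrite lt_neqAle eq_sym y0 rnorm_ge0.
rewrite -(ler_pM2r y0) -expr2 -[leLHS](@rnorm_real R) ?sqr_ge0// -inner_self -TS.
apply: le_trans (cauchy_schwarz _ _) _.
by rewrite mulrAC ler_wpM2r ?rnorm_ge0.
Qed.

Lemma adjointP T : bounded_operator T -> is_adjoint T T^\star.
Proof. by move=> /adjoint_exists; exact: getPex. Qed.

Lemma adjoint_eq T S : is_adjoint T S -> T^\star = S.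
Proof.
move=> TS; have [_ TT] : is_adjoint T T^\star.
  by apply: (@getPex _ [set X | is_adjoint T X]); exists S.
by apply/funext => y; apply: inner_inj => x; rewrite -TT TS.2.
Qed.

(** Only [S] is known to be bounded here; the boundedness of [T] comes from that
    of the adjoint of [S], with which [T] coincides. *)
Lemma is_adjointC T S : is_adjoint T S -> is_adjoint S T.
Proof.
move=> [bS TS]; have [bS' SS'] := adjointP S bS.
suff -> : T = S^\star by [].
by apply/funext => y; apply: inner_inj => x; rewrite -SS' innerC TS -innerC.
Qed.

Lemma bounded_comp T S :
  bounded_operator T -> bounded_operator S -> bounded_operator (T \o S).
Proof.
move=> bT bS; have [M M0 TM] := bounded_rnorm T bT.
have [N N0 SN] := bounded_rnorm S bS.
apply: (rnorm_bounded _ (M * N)); first by move=> a x y; rewrite /= bS.1 bT.1.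
move=> x /=; apply: le_trans (TM _) _; rewrite -mulrA.
by rewrite ler_wpM2l.
Qed.

Lemma is_adjoint_comp T S T' S' :
  is_adjoint T T' -> is_adjoint S S' -> is_adjoint (T \o S) (S' \o T').
Proof.
move=> [bT' TT'] [bS' SS']; split; first exact: bounded_comp.
by move=> x y; rewrite /= TT' SS'.
Qed.

End Adjoints.

(** * Uniform boundedness *)

Section UniformBoundedness.
Context {R : realType} {H : hilbertType R}.
Implicit Types (x y w : H).

(** With [h] the multiple of [w] of norm [r / 2], the pairings of [x + h] and
    [x - h] with [w] differ by [r * rnorm w], so one of them is at least half of
    that; moving by [r / 4] changes it by at most [r / 4 * rnorm w]. *)
Lemma large_on_subball (W : set H) (n : nat) (r : R) x :
    0 < r -> (forall C : R, exists2 w, W w & C < rnorm w) ->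
  exists x', rnorm (x' - x) <= r / 2 /\
    exists2 w, W w &
      forall y, rnorm (y - x') <= r / 4 -> n%:R <= rnorm (inner y w).
Proof.
move=> r0 unbdd; have [w Ww nw] := unbdd (4 * n%:R / r).
set t := rnorm w in nw.
have t0 : 0 < t by apply: le_lt_trans nw; rewrite divr_ge0 ?mulr_ge0// ltW.
rewrite ltr_pdivrMr// in nw.
pose h : H := (r / 2 / t)%:C%C *: w.
have hn : rnorm h = r / 2
  by rewrite rnormZ rnorm_real ?divr_ge0 ?ltW// -/t divfK// gt_eqF.
have [x' x'x x'w] : exists2 x', rnorm (x' - x) = r / 2 &
    r * t / 2 <= rnorm (inner x' w).
  have : r * t <= rnorm (inner (x + h) w) + rnorm (inner (x - h) w).
    have -> : r * t = rnorm (inner ((x + h) - (x - h)) w).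
      rewrite opprB [h - x]addrC addrACA subrr add0r.
      rewrite -scalerDl -rmorphD -mulrDl -splitr.
      rewrite innerZl rnormM rnorm_real ?divr_ge0 ?ltW//.
      rewrite inner_self rnorm_real ?sqr_ge0// -/t.
      by field; rewrite gt_eqF.
    by rewrite innerBl; apply: le_trans (rnormD _ _) _; rewrite rnormN.
  have [le1|lt1] := leP (r * t / 2) (rnorm (inner (x + h) w)).
    by exists (x + h); rewrite // addrC addKr.
  exists (x - h); first by rewrite addrC addKr rnormN.
  lra.
exists x'; split; first by rewrite x'x.
exists w => // y yx'.
have := rnormD (inner y w) (- inner (y - x') w).
rewrite rnormN -innerBl opprB addrC subrK => D.
have := le_trans (cauchy_schwarz (y - x') w) (ler_wpM2r (rnorm_ge0 w) yx').
rewrite -/t => D2; lra.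
Qed.

(** The uniform boundedness principle for the functionals [inner ^~ w].  If [W]
    were unbounded, there would be nested balls, of radius [4 ^- n], such that
    each point of the [n.+1]-th one pairs to at least [n] with some element of
    [W], and the pairings with their common point would be unbounded. *)
Lemma uniform_boundedness (W : set H) :
    (forall y, exists M : R, forall w, W w -> rnorm (inner y w) <= M) ->
  exists C : R, forall w, W w -> rnorm w <= C.
Proof.
move=> ptw; apply: contrapT => nC.
have unbdd (C : R) : exists2 w, W w & C < rnorm w.
  apply: contrapT => nw; apply: nC; exists C => w Ww.
  by rewrite leNgt; apply/negP => Cw; apply: nw; exists w.
pose r n : R := 4 ^- n.
have r0 n : 0 < r n by rewrite invr_gt0 exprn_gt0.
have rS n : r n.+1 = r n / 4 by rewrite /r exprSr invfM.
have [f fP] := choice (fun q : nat * H =>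
  large_on_subball W q.1 (r q.1) q.2 (r0 _) unbdd).
pose fix x n := if n is m.+1 then f (m, x m) else 0.
have nested n m : (n <= m)%N -> rnorm (x m - x n) + r m <= r n.
  elim: m => [|m IH].
    by rewrite leqn0 => /eqP ->; rewrite subrr rnorm0 add0r.
  rewrite leq_eqVlt => /orP[/eqP ->|/IH {}IH].
    by rewrite subrr rnorm0 add0r.
  have [D _] := fP (m, x m); rewrite /= in D.
  have := rnormD (x m.+1 - x m) (x m - x n); rewrite addrA subrK /= rS.
  have := r0 m; lra.
have near n m : (n <= m)%N -> rnorm (x m - x n) <= r n.
  by move=> /nested; apply: le_trans; rewrite lerDl ltW.
have rsmall (n : nat) : r n <= n.+1%:R^-1.
  by rewrite /r lef_pV2 ?posrE ?exprn_gt0// -natrX ler_nat; exact: ltn_expl.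
have [|l lP] := cauchy_limit x.
  move=> e e0; have [N NP] := inv_natS_small _ e0; exists N => n Nn.
  rewrite rnormBC; apply: le_lt_trans (near _ _ Nn) _.
  by apply: le_lt_trans (rsmall _) (NP _ _).
have lx n : rnorm (l - x n) <= r n.
  apply/ler_addgt0Pl => e e0; have [N NP] := lP e e0.
  have -> : l - x n = (l - x (maxn N n)) + (x (maxn N n) - x n).
    by rewrite addrA subrK.
  apply: le_trans (rnormD _ _) _; apply: lerD.
    by rewrite ltW// NP// leq_maxl.
  by rewrite near// leq_maxr.
have [M MP] := ptw l.
have [_ [w' Ww' w'P]] := fP ((Num.truncn M).+1, x (Num.truncn M).+1).
have := MP w' Ww'; apply/negP; rewrite -ltNge.
apply: lt_le_trans (truncnS_gt M) (w'P _ _).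
by rewrite /= -rS; exact: lx (Num.truncn M).+2.
Qed.

End UniformBoundedness.

(** * Existence of Moore-Penrose inverses *)

Section MoorePenrose.
Context {R : realType} {H : hilbertType R}.
Implicit Types (T S X : H -> H) (x y z v w : H).

(** Elements [w] of [range T] with [rnorm (T^\star w) <= 1] pair boundedly with
    every vector: only the orthogonal projection on [range T] of the vector
    matters, and for [T x] the pairing is [inner x (T^\star w)]. *)
Lemma adjoint_bounded_below T : bounded_operator T -> closed (range T) ->
  exists2 C : R, 0 <= C & forall x, rnorm (T x) <= C * rnorm (T^\star (T x)).
Proof.
move=> bT clT; have [bS TS] := adjointP T bT; set S := T^\star in bS TS *.
have lT := bT.1; have lS := bS.1.
pose W := [set T x | x in [set x | rnorm (S (T x)) <= 1]].
have [y|C CW] := @uniform_boundedness R H W.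
  have [|k _ _ [a _ <-] [b _ <-]|m /(closed_adherent _ _ clT)[x _ <-] orth] :=
    orthogonal_decomposition (range T) y.
  - by exists 0; rewrite ?(linear_fun0 lT).
  - by exists (k *: a + b); rewrite ?lT.
  exists (rnorm x) => _ [z /= z1 <-].
  rewrite -[y](subrK (T x)) innerDl orth; last by exists z.
  rewrite add0r TS; apply: le_trans (cauchy_schwarz _ _) _.
  by rewrite ler_piMr ?rnorm_ge0.
have C0 : 0 <= C.
  by apply: le_trans (CW (T 0) _); rewrite ?rnorm_ge0//; exists 0 => //=;
     rewrite (linear_fun0 lT) (linear_fun0 lS) rnorm0.
exists C => // x; have [s0|s0] := eqVneq (rnorm (S (T x))) 0.
  rewrite s0 mulr0; suff -> : T x = 0 by rewrite rnorm0.
  apply/eqP; rewrite -(dnorm_eq0 inner) TS (rnorm_eq0 _ s0).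
  by rewrite innerC inner0l rmorph0.
set s := rnorm _ in s0 *.
have {}s0 : 0 < s by rewrite lt_neqAle eq_sym s0 rnorm_ge0.
have sV : 0 <= s^-1 by rewrite invr_ge0 ltW.
have := CW (T ((s^-1)%:C%C *: x)).
rewrite (linear_funZ lT) rnormZ rnorm_real// ler_pdivrMl// mulrC; apply.
exists ((s^-1)%:C%C *: x); last by rewrite (linear_funZ lT).
by rewrite /= (linear_funZ lT) (linear_funZ lS) rnormZ rnorm_real// mulVf// gt_eqF.
Qed.

(** The vectors orthogonal to the kernel of [T] are adherent to the range of
    [T^\star \o T], where the lower bound for [T^\star] on [range T] turns the
    equality [inner (T^\star (T z)) x = inner (T z) (T x)] into an estimate. *)
Lemma bounded_below_ker_orth T : bounded_operator T -> closed (range T) ->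
  exists2 C : R, 0 <= C & forall x, (forall k, T k = 0 -> inner x k = 0) ->
    rnorm x <= C * rnorm (T x).
Proof.
move=> bT clT; have [C C0 CT] := adjoint_bounded_below T bT clT.
have [bS TS] := adjointP T bT; set S := T^\star in bS TS CT.
have lT := bT.1; have lS := bS.1.
exists C => // x x_orth.
have [|k _ _ [a _ <-] [b _ <-]|m m_adh m_orth] :=
  orthogonal_decomposition (range (S \o T)) x.
- by exists 0; rewrite //= (linear_fun0 lT) (linear_fun0 lS).
- by exists (k *: a + b); rewrite //= lT lS.
have {m_orth m_adh} x_adh : adherent (range (S \o T)) x.
  suff -> : x = m by [].
  have Txm : T (x - m) = 0.
    by apply/eqP; rewrite -(dnorm_eq0 inner) TS m_orth//; exists (x - m).
  apply/eqP; rewrite -subr_eq0 -(dnorm_eq0 inner) innerBl x_orth// sub0r oppr_eq0.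
  apply/eqP; apply: (@adherent_kernel R H R[i] (inner^~ (x - m)) (rnorm (x - m))).
  - exact: rnorm_ge0.
  - by move=> u v; exact: innerBl.
  - by move=> u; rewrite mulrC; exact: cauchy_schwarz.
  - move=> e e0; have [_ [z _ <-] mz] := m_adh e e0; exists (S (T z)) => //=.
    by rewrite innerC -TS Txm inner0l rmorph0.
have [x0|x0] := eqVneq (rnorm x) 0.
  by rewrite x0 mulr_ge0// rnorm_ge0.
have {}x0 : 0 < rnorm x by rewrite lt_neqAle eq_sym x0 rnorm_ge0.
rewrite -(ler_pM2r x0) -subr_le0.
apply: (le0_small _ (C * rnorm (T x) + rnorm x)).
  by rewrite addr_ge0 ?mulr_ge0 ?rnorm_ge0.
move=> e e0; have [_ [z _ <-] /= xz] := x_adh e e0; set u := S (T z) in xz.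
have xx : rnorm x * rnorm x <= rnorm (inner u x) + rnorm (inner (x - u) x).
  rewrite -expr2 -[leLHS](@rnorm_real R) ?sqr_ge0// -inner_self.
  have -> : inner x x = inner u x + inner (x - u) x.
    by rewrite -innerDl [u + _]addrC subrK.
  exact: rnormD.
have ux : rnorm (inner u x) <= C * rnorm u * rnorm (T x).
  rewrite rnorm_innerC -TS rnorm_innerC; apply: le_trans (cauchy_schwarz _ _) _.
  by rewrite ler_wpM2r ?rnorm_ge0//; exact: CT.
have xux : rnorm (inner (x - u) x) <= e * rnorm x.
  by apply: le_trans (cauchy_schwarz _ _) _; rewrite ler_wpM2r ?rnorm_ge0// ltW.
have un : rnorm u <= rnorm x + e.
  have := rnormD x (u - x); rewrite addrC subrK rnormBC; lra.
have := ler_wpM2r (rnorm_ge0 (T x)) (ler_wpM2l C0 un); lra.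
Qed.

(** [X y] is the solution of [T x = P y] orthogonal to the kernel of [T], where
    [P] is the orthogonal projection on [range T]; all the required identities
    follow from this characterization, which determines [X y]. *)
Lemma mp_inverse_exists T : bounded_operator T -> closed (range T) ->
  exists X, is_mp_inverse T X.
Proof.
move=> bT clT; have lT := bT.1; have [M M0 TM] := bounded_rnorm T bT.
have [C C0 CT] := bounded_below_ker_orth T bT clT.
have sol y : exists x, (forall k, T k = 0 -> inner x k = 0) /\
    (forall z, inner (y - T x) (T z) = 0).
  have [|k _ _ [a _ <-] [b _ <-]|_ /(closed_adherent _ _ clT)[x _ <-] orth] :=
    orthogonal_decomposition (range T) y.
  - by exists 0; rewrite ?(linear_fun0 lT).
  - by exists (k *: a + b); rewrite ?lT.
  have [|k a b /= a0 b0|m m_adh m_orth] :=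
    orthogonal_decomposition [set k | T k = 0] x.
  - exact: linear_fun0 lT.
  - by rewrite lT a0 b0 scaler0 addr0.
  have Tm : T m = 0 by exact: adherent_kernel M0 (linear_funB lT) TM m_adh.
  exists (x - m); split=> // z; rewrite (linear_funB lT) Tm subr0.
  by apply: orth; exists z.
have [X XP] := choice sol.
have Xker y k : T k = 0 -> inner (X y) k = 0 by exact: (XP y).1.
have Xran y z : inner y (T z) = inner (T (X y)) (T z).
  by apply/eqP; rewrite -subr_eq0 -innerBl (XP y).2.
have uniq x x' : (forall k, T k = 0 -> inner x k = 0) ->
    (forall k, T k = 0 -> inner x' k = 0) ->
    (forall z, inner (T x) (T z) = inner (T x') (T z)) -> x = x'.
  move=> xk x'k xx'; apply/eqP; rewrite -subr_eq0; apply/eqP/rnorm_eq0/le_anti.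
  have T0 : T (x - x') = 0.
    apply/eqP; rewrite -(dnorm_eq0 inner) {1}(linear_funB lT) innerBl xx'.
    by rewrite subrr.
  rewrite rnorm_ge0 andbT; apply: le_trans (CT (x - x') _) _ => [k Tk|].
    by rewrite innerBl xk// x'k// subrr.
  by rewrite T0 rnorm0 mulr0.
have TXT x : T (X (T x)) = T x.
  apply/eqP; rewrite -subr_eq0 -(linear_funB lT) -(dnorm_eq0 inner).
  by rewrite {1}(linear_funB lT) innerBl -Xran subrr.
have bX : bounded_operator X.
  apply: (rnorm_bounded _ C) => [a u v|y].
    apply: uniq => [|k Tk|z]; first exact: Xker.
      by rewrite innerDl innerZl !Xker// mulr0 addr0.
    by rewrite -Xran lT !innerDl !innerZl -!Xran.
  apply: le_trans (CT _ (Xker y)) _; rewrite ler_wpM2l//.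
  have [->|y0] := eqVneq (rnorm (T (X y))) 0; first exact: rnorm_ge0.
  have {}y0 : 0 < rnorm (T (X y)) by rewrite lt_neqAle eq_sym y0 rnorm_ge0.
  rewrite -(ler_pM2r y0) -expr2 -[leLHS](@rnorm_real R) ?sqr_ge0// -inner_self.
  by rewrite -Xran cauchy_schwarz.
exists X; split=> //.
- by apply/funext => x /=; rewrite TXT.
- apply/funext => y /=; apply: uniq => [||z]; try exact: Xker.
  by rewrite TXT.
- apply: adjoint_eq; split=> [|x y /=]; first exact: bounded_comp.
  have Tker u : T (u - X (T u)) = 0 by rewrite (linear_funB lT) TXT subrr.
  have /eqP := Xker (T x) _ (Tker y); rewrite innerBr subr_eq0 => /eqP ->.
  have /eqP := Xker (T y) _ (Tker x); rewrite innerBr subr_eq0 => /eqP yx.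
  by rewrite [RHS]innerC yx -innerC.
- apply: adjoint_eq; split=> [|x y /=]; first exact: bounded_comp.
  by rewrite [RHS]Xran innerC Xran -innerC.
Qed.

End MoorePenrose.

(** * Polynomials in an operator *)

Section Polynomials.
Context {R : realType} {H : hilbertType R}.
Implicit Types (T S X A : H -> H) (p : {poly R[i]}) (x y z : H).

Lemma poly_op_comm p T x : linear T -> poly_op p T (T x) = T (poly_op p T x).
Proof.
move=> lT; rewrite /poly_op (big_morph T (linear_funD lT) (linear_fun0 lT)).
by apply: eq_bigr => i _; rewrite (linear_funZ lT) -iterSr.
Qed.

(** When [p] has no constant term, [p(T)] is a multiple of [T] on each side; a
    map that fixes [T] under composition therefore fixes [p(T)]. *)
Lemma poly_op_absorbl p T S x : p.[0] = 0 -> linear S ->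
  (forall z, S (T z) = T z) -> S (poly_op p T x) = poly_op p T x.
Proof.
move=> p0 lS ST; rewrite /poly_op (big_morph S (linear_funD lS) (linear_fun0 lS)).
apply: eq_bigr => -[[|i] ip] _ /=; rewrite (linear_funZ lS) ?ST//.
by rewrite -horner_coef0 p0 !scale0r.
Qed.

Lemma poly_op_absorbr p T S x : p.[0] = 0 ->
  (forall z, T (S z) = T z) -> poly_op p T (S x) = poly_op p T x.
Proof.
move=> p0 TS; apply: eq_bigr => -[[|i] ip] _.
  by rewrite /= -horner_coef0 p0 !scale0r.
by rewrite [val _]/= !iterSr TS.
Qed.

Lemma is_adjoint0 : is_adjoint (fun=> 0 : H) (fun=> 0 : H).
Proof.
split=> [|x y]; last by rewrite [RHS]innerC !inner0l rmorph0.
apply: (rnorm_bounded _ 0) => [a x y|x]; first by rewrite scaler0 addr0.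
by rewrite rnorm0 mul0r.
Qed.

Lemma is_adjoint_id : is_adjoint (@id H) id.
Proof. by split=> //; apply: (rnorm_bounded _ 1) => // x; rewrite mul1r. Qed.

Lemma is_adjoint_linear_comb (a : R[i]) T T' S S' :
    is_adjoint T T' -> is_adjoint S S' ->
  is_adjoint (fun x => a *: T x + S x) (fun x => Num.conj a *: T' x + S' x).
Proof.
move=> [bT TT'] [bS SS']; split; last first.
  by move=> x y; rewrite innerDl innerZl innerDr innerZr conjCK TT' SS'.
have [M M0 TM] := bounded_rnorm _ bT; have [N N0 SN] := bounded_rnorm _ bS.
apply: (rnorm_bounded _ (rnorm a * M + N)).
  move=> b x y; rewrite bT.1 bS.1 !scalerDr !scalerA [b * _]mulrC.
  by rewrite addrACA.
move=> x; apply: le_trans (rnormD _ _) _; rewrite mulrDl rnormZ rnormJ -mulrA.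
by apply: lerD => //; rewrite ler_wpM2l ?rnorm_ge0.
Qed.

Lemma is_adjoint_iter n T S : is_adjoint T S -> is_adjoint (iter n T) (iter n S).
Proof.
move=> TS; elim: n => [|n IH]; first exact: is_adjoint_id.
have -> : iter n.+1 S = iter n S \o S by apply/funext => x; exact: iterSr.
exact: is_adjoint_comp.
Qed.

Lemma is_adjoint_poly_op p T S :
  is_adjoint T S -> is_adjoint (poly_op p T) (poly_op (conj_poly p) S).
Proof.
move=> TS; rewrite /poly_op /conj_poly size_map_poly.
under [X in is_adjoint _ X]eq_fun do under eq_bigr do rewrite coef_map.
elim: (size p) => [|n IH].
  under eq_fun do rewrite big_ord0.
  under [X in is_adjoint _ X]eq_fun do rewrite big_ord0.
  exact: is_adjoint0.
under eq_fun do rewrite big_ord_recr /= addrC.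
under [X in is_adjoint _ X]eq_fun do rewrite big_ord_recr /= addrC.
apply: is_adjoint_linear_comb => //=.
exact: is_adjoint_iter.
Qed.

End Polynomials.

(** * The characterization *)

Theorem theorem1 (R : realType) (H : hilbertType R) (T : H -> H)
    (bT : bounded_operator T) (clT : closed (range T))
    (p : {poly R[i]}) (p0 : p.[0] = 0) :
  [<-> p_EP p T;
       T \o T^\dag \o (T^\dag \o poly_op p T)^\star
         = (T^\dag \o poly_op p T)^\star /\
       T^\dag \o T \o poly_op p T \o T^\dag = poly_op p T \o T^\dag;
       (poly_op p T \o T \o T^\dag) \+ (poly_op p T \o T \o T^\dag)^\star
         = poly_op p T \+ poly_op (conj_poly p) T^\star /\
       (T^\dag \o poly_op p T \o T) \+ (T^\dag \o poly_op p T \o T)^\star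
         = poly_op p T \+ poly_op (conj_poly p) T^\star].
Proof.
have TX : is_mp_inverse T T^\dag by exact: getPex (mp_inverse_exists T bT clT).
have aA := is_adjoint_poly_op p _ _ (adjointP T bT).
rewrite /p_EP; set B := poly_op (conj_poly p) _ in aA *.
move: TX aA; set X := T^\dag; set A := poly_op p T => -[bX TXT XTX eQ eP] aA.
have lT := bT.1; have lX := bX.1.
have aQ : is_adjoint (X \o T) (X \o T).
  by rewrite -[in X in is_adjoint _ X]eQ; apply: adjointP; exact: bounded_comp.
have aP : is_adjoint (T \o X) (T \o X).
  by rewrite -[in X in is_adjoint _ X]eP; apply: adjointP; exact: bounded_comp.
have TXTE x : T (X (T x)) = T x by exact: (congr1 (@^~ x) TXT).
have XTXE x : X (T (X x)) = X x by exact: (congr1 (@^~ x) XTX).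
have PA x : T (X (A x)) = A x.
  by apply: (poly_op_absorbl p T (T \o X)) => //; exact: aP.1.1.
have AQ x : A (X (T x)) = A x by exact: (poly_op_absorbr p T (X \o T)).
have AT x : A (T x) = T (A x) by exact: poly_op_comm.
have bA : bounded_operator A := (is_adjointC _ _ aA).1.
tfae.
- move=> [_ AX]; have {}AX x : A (X x) = X (A x) by exact: (congr1 (@^~ x) AX).
  have [bS XAS] := adjointP _ (bounded_comp _ _ bX bA).
  split; apply/funext => x /=.
    apply: inner_inj => z; rewrite -(aP.2 z) -!XAS /=.
    by rewrite -!AX XTXE.
  by rewrite AX PA.
- move=> [PS QAX].
  have [bS XAS] := adjointP _ (bounded_comp _ _ bX bA).
  (* [X A P = X A] is the adjoint of the first equation; [T] turns [X A] into
     [A]. *)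
  have AP x : A (T (X x)) = A x.
    rewrite -PA -[RHS]PA; congr T; apply: inner_inj => z.
    rewrite innerC [RHS]innerC; congr Num.conj; rewrite [LHS]XAS [RHS]XAS.
    by rewrite [LHS](aP.2 x) -[in RHS]PS.
  have QA x : X (T (A x)) = A x.
    by have /= := congr1 (@^~ (T x)) QAX; rewrite !AQ.
  have -> : A \o T \o X = A by apply/funext => x /=.
  have -> : X \o A \o T = A by apply/funext => x /=; rewrite AT.
  by rewrite (adjoint_eq _ _ aA).
- move=> [e1 e2]; split=> //.
  (* [A P + P B = A + B], where [B] is the adjoint of [A], is composed with [P]
     on the left. *)
  have AP x : A (T (X x)) = A x.
    have := congr1 (@^~ x) e1; rewrite /= -[A \o T \o X]/(A \o (T \o X)).
    rewrite (adjoint_eq _ _ (is_adjoint_comp _ _ _ _ aA aP)) /=.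
    move=> /(congr1 (T \o X)).
    rewrite /= !(linear_funD lX) !(linear_funD lT) !PA TXTE.
    exact: addIr.
  (* [Q A + B Q = A + B] is composed with [Q] on the right. *)
  have QA x : X (T (A x)) = A x.
    have := congr1 (@^~ (X (T x))) e2.
    have -> : X \o A \o T = (X \o T) \o A by apply/funext => z /=; rewrite AT.
    rewrite (adjoint_eq _ _ (is_adjoint_comp _ _ _ _ aQ aA)) /= XTXE !AQ.
    exact: addIr.
  by apply/funext => x /=; rewrite -QA -AT AP.
Qed.
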